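(* Let $G$ be a profinite group. Assume that for all but finitely many prime numbers $p$, the group $G^{(p)}$ is finite with order bounded above by a polynomial in $p$ (i.e. there is a single polynomial $f$ such that $\#G^{(p)}\le f(p)$ for all but finitely many primes $p$). Then $G$ is finite.
   Context: For a profinite group $G$ and a prime $p$, $G^{(p)}$ denotes the projective limit of all continuous finite quotients of $G$ of order prime to $p$. *)

(* Defs.v *)
From HB Require Import structures.
From mathcomp Require Import all_boot all_order all_algebra.
From mathcomp Require Import finmap.
From mathcomp Require Import all_classical all_reals all_analysis.

Local Open Scope classical_set_scope.

HB.mixin Record isTopologicalGroup G of Topological G & Group G := {
  mulg_continuous : continuous (fun xy : G * G => (xy.1 * xy.2)%g) ;
  invg_continuous : continuous (fun x : G => (x^-1)%g)
}.

#[short(type="topologicalGroupType")]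
HB.structure Definition TopologicalGroup :=
  {G of Topological G & Group G & isTopologicalGroup G}.

Definition profinite (G : topologicalGroupType) : Prop :=
  [/\ compact [set: G], hausdorff_space G & totally_disconnected [set: G]].

Section Quotients.
Context {G : groupType}.

Definition normal_subgroup (N : set G) : Prop :=
  [/\ N 1%g,
      forall x y, N x -> N y -> N (x * y^-1)%g
    & forall x g, N x -> N (x ^ g)%g].

Definition left_coset (g : G) (N : set G) : set G := [set (g * x)%g | x in N].

(* The underlying set of G / N. *)
Definition cosets (N : set G) : set (set G) :=
  range (fun g => left_coset g N).

(* The underlying set of the projective limit of the groups G / N, for N in S.
   For M `<=` N the transition map G / M -> G / N sends gM to gN, which is the
   only coset of N that contains gM; so the coherence condition on the family
   x amounts to the inclusion x M `<=` x N. *)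
Definition quotient_limit (S : set (set G)) : set (S -> set G) :=
  [set x | (forall N : S, cosets (val N) (x N)) /\
           (forall M N : S, val M `<=` val N -> x M `<=` x N)].

End Quotients.

(* #|` fset_set A| is the number of elements of A only when A is finite. *)
Definition has_order {T : choiceType} (A : set T) (n : nat) : Prop :=
  finite_set A /\ #|` fset_set A| = n.

(* The continuous finite quotients of G are the finite G / N with N an open
   normal subgroup. *)
Definition prime_to_kernels (G : topologicalGroupType) (p : nat) :
    set (set G) :=
  [set N | [/\ open N, normal_subgroup N
             & exists2 n, has_order (cosets N) n & coprime p n]].

Definition prime_to_quotient (G : topologicalGroupType) (p : nat) :
    set (prime_to_kernels G p -> set G) :=
  quotient_limit (prime_to_kernels G p).

(* Main.v *)
Require Import Defs.
From HB Require Import structures.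
From mathcomp Require Import all_boot all_order all_algebra.
From mathcomp Require Import finmap zify.
From mathcomp Require Import all_classical all_reals all_analysis.

(** Let [h] be the order of a finite quotient [G / N].  For every prime [p]
    not dividing [h], the group [G^(p)] maps onto [G / N], so that
    [h <= #G^(p)] ([card_cosets_le]).  Fix [b] beyond the finitely many primes
    at which the bound [#G^(p) <= f(p)] fails, and let [p] be the least prime
    [p >= b] that does not divide [h]: then [h <= f(p)], while [h] is divisible
    by all the primes in [[b, p)], whose product outgrows any polynomial in
    [p].  So [p], and with it [h], is bounded independently of [N]
    ([leq_of_primes_dvdn]).  A profinite group whose quotients by open normal
    subgroups have bounded order is finite ([profinite_finite]).

    Arithmetic.  What is needed is a bound for [p] by the primes below it that
    is exponential in their number.  Erdos's count suffices: writing each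
    [n <= x] as a square times a product of distinct primes gives
    [x <= 4 ^ pi(x)] ([leq_exp4_primes]).  At most [b] of the primes below [p]
    are smaller than [b], so if [s] primes lie in [[b, p)] and [C p ^ k] bounds
    [f(p)], then [b ^ s <= h <= C p ^ k <= C' (4 ^ k) ^ s], and choosing
    [b >= 2 * 4 ^ k] forces [2 ^ s <= C'].

    Topology.  Points of a profinite group are separated from [1] by open
    normal subgroups ([open_normal_avoiding]).  A compact Hausdorff totally
    disconnected space has enough clopen sets because the intersection of the
    clopen sets around a point is connected ([connected_quasi_component]).
    Given a clopen set [U] containing [1], the elements [g] such that [a b]
    and [a g b] are never separated by [U] form a normal subgroup contained in
    [U], and it is open by compactness of [G * G]. *)

Import Order.TTheory GRing.Theory Num.Theory.
Set Implicit Arguments.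
Unset Strict Implicit.
Unset Printing Implicit Defensive.

(** * Primes below a given bound *)

Lemma square_mul_squarefreeE x n : 0 < n <= x ->
  n = (\prod_(i < x.+1) i ^ (logn i n)./2) ^ 2
      * \prod_(i < x.+1 | odd (logn i n)) i.
Proof.
case/andP=> n0 nx; rewrite -[LHS]partnT // (widen_partn _ nx) big_mkord.
rewrite [in X in _ * X]big_mkcond /= expnS expn1 -!big_split /=.
apply: eq_bigr => i _; rewrite -[in LHS](odd_double_half (logn i n)).
rewrite expnD -addnn expnD mulnC.
by case: (odd _) => /=; rewrite ?expn1 ?expn0.
Qed.

(** Erdos's argument: if [x] exceeded [4 ^ s], with [s] the number of primes up
    to [x], then each [n] with [1 <= n <= 4 ^ s + 1] would be determined by
    the set of primes at which its valuation is odd ([2 ^ s] choices) and by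
    the square root of its square part, which is at most [2 ^ s]. *)
Lemma leq_exp4_primes x : x <= 4 ^ #|[set i : 'I_x.+1 | prime i]|.
Proof.
set P := [set i | _]; set s := #|P|.
have [//|lt_x] := leqP x (4 ^ s); exfalso.
have E4 : 4 ^ s = 2 ^ s * 2 ^ s by rewrite -expnMn.
set N := (4 ^ s).+1.
pose m (n : nat) := \prod_(i < x.+1) i ^ (logn i n)./2.
have nE (n : 'I_N) : n.+1 =
    m n.+1 ^ 2 * \prod_(i < x.+1 | odd (logn i n.+1)) i.
  by apply: square_mul_squarefreeE; rewrite (leq_trans (ltn_ord n)).
have m_gt0 (n : 'I_N) : 0 < m n.+1.
  by have := nE n; case: (m _) => //=.
have m_le (n : 'I_N) : (m n.+1).-1 < 2 ^ s.
  rewrite -ltnS prednK // ltnS leqNgt; apply/negP => lt_m.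
  (* The square of [2 ^ s + 1] already exceeds [4 ^ s + 1]. *)
  have : (2 ^ s).+1 ^ 2 <= n.+1.
    rewrite nE -[leqLHS]muln1 leq_mul ?leq_exp2r //.
    by have := nE n; case: (\prod_(i < _ | _) _); rewrite ?muln0.
  have : n < (2 ^ s * 2 ^ s).+1 by rewrite -E4 ltn_ord.
  by rewrite expnS expn1; lia.
pose T := ({set 'I_x.+1} * 'I_(2 ^ s))%type.
(* All indices are shifted: [n : 'I_N] stands for the integer [n.+1], and the
   second component for [m n.+1 - 1]. *)
pose f (n : 'I_N) : T :=
  ([set i : 'I_x.+1 | odd (logn i n.+1)], Ordinal (m_le n)).
have f_inj : injective f.
  move=> n1 n2 [/setP eqS eqm]; apply/val_inj/succn_inj.
  rewrite (nE n1) (nE n2) -(prednK (m_gt0 n1)) -(prednK (m_gt0 n2)) eqm.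
  by congr (_ * _); apply: eq_bigl => i; have := eqS i; rewrite !inE.
have sub_f :
    f @: [set: 'I_N] \subset finset.setX (powerset P) [set: 'I_(2 ^ s)].
  apply/fintype.subsetP => _ /imsetP[n _ ->]; rewrite !inE andbT.
  apply/fintype.subsetP => i; rewrite !inE => odd_i.
  by apply: contraTT odd_i => /negbTE npr; rewrite lognE npr.
have := subset_leq_card sub_f; rewrite card_imset // cardsX card_powerset.
by rewrite !cardsT !card_ord -/s -E4 ltnn.
Qed.

Lemma prod_primes_dvdn (s : seq nat) h :
  uniq s -> (forall q, q \in s -> prime q && (q %| h)) -> \prod_(q <- s) q %| h.
Proof.
elim: s => [|q s IH] /=; first by rewrite big_nil dvd1n.
move=> /andP[qs us] sh; rewrite big_cons.
have /andP[pq qh] := sh q (mem_head _ _).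
have ssh r : r \in s -> prime r && (r %| h).
  by move=> rs; apply: sh; rewrite inE rs orbT.
rewrite Gauss_dvd ?qh ?IH // big_seq.
elim/big_rec: _ => [|r y rs cqy]; first exact: coprimen1.
have /andP[pr _] := ssh _ rs.
rewrite coprimeMr cqy andbT prime_coprime // dvdn_prime2 //.
by apply: contraNneq qs => ->.
Qed.

(** Here [s] is the number of primes in [[b, p)]; their product divides [h],
    and there are at most [b] primes below [b]. *)
Lemma exp_primes_leq b p h : 0 < h ->
  (forall q, prime q -> b <= q -> q < p -> q %| h) ->
  exists2 s, p <= (4 ^ (s + b)).+1 & b ^ s <= h.
Proof.
move=> h0 bph.
pose r := [seq q <- index_iota b p | prime q].
have rE q : q \in r = [&& prime q, b <= q & q < p].
  by rewrite mem_filter mem_index_iota.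
exists (size r); last first.
  apply: (@leq_trans (\prod_(q <- r) q)); last first.
    apply: dvdn_leq => //; apply: prod_primes_dvdn.
      by rewrite filter_uniq ?iota_uniq.
    by move=> q; rewrite rE => /and3P[pq bq qp]; rewrite pq bph.
  have -> : b ^ size r = \prod_(q <- r) b.
    by rewrite big_const_seq count_predT iter_muln_1.
  by rewrite big_seq [leqRHS]big_seq leq_prod // => q; rewrite rE => /and3P[].
case: p bph r rE => [//|p] bph r rE; rewrite ltnS.
apply: leq_trans (leq_exp4_primes p) _; rewrite leq_exp2l //.
rewrite cardE -(size_map val) addnC -{1}(size_iota 0 b) -size_cat.
apply: uniq_leq_size.
  by rewrite map_inj_uniq ?enum_uniq //; exact: val_inj.
move=> _ /mapP[i + ->]; rewrite mem_enum inE => pi.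
rewrite mem_cat mem_iota rE add0n pi ltn_ord /= andbT.
by case: (ltnP i b).
Qed.

Lemma leq_expl k m n : m <= n -> m ^ k <= n ^ k.
Proof. by case: k => // k; rewrite leq_exp2r. Qed.

(** With [s] primes in [[b, p)], the two bounds of [exp_primes_leq] give
    [2 ^ s * (4 ^ k) ^ s <= b ^ s <= h <= D * (4 ^ k) ^ s], where [D] does not
    depend on [p] and [h]; so [s < 2 ^ s <= D]. *)
Lemma leq_of_primes_dvdn b C k : 2 * 4 ^ k <= b ->
  exists M, forall p h, 0 < h ->
    (forall q, prime q -> b <= q -> q < p -> q %| h) ->
    h <= C * p ^ k -> h <= M.
Proof.
move=> leb; pose D := C * 2 ^ k * (4 ^ b) ^ k.
exists (D * (4 ^ k) ^ D) => p h h0 bph hp.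
have [s ps bs] := exp_primes_leq h0 bph.
have hD : h <= D * (4 ^ k) ^ s.
  apply: leq_trans hp _; rewrite /D -!mulnA leq_mul2l; apply/orP; right.
  rewrite [(4 ^ k) ^ s]expnAC -!expnMn leq_expl //.
  apply: leq_trans ps _; rewrite expnD.
  by have : 0 < 4 ^ s * 4 ^ b; [rewrite muln_gt0 !expn_gt0 | lia].
suff sD : s <= D.
  by apply: leq_trans hD _; rewrite leq_mul2l leq_pexp2l ?expn_gt0 ?orbT.
have : 2 ^ s * (4 ^ k) ^ s <= D * (4 ^ k) ^ s.
  rewrite -expnMn; apply: leq_trans hD; apply: leq_trans bs.
  exact: leq_expl.
rewrite leq_pmul2r ?expn_gt0 // => /(leq_trans _); apply.
exact/ltnW/ltn_expl.
Qed.

Lemma least_prime_not_dvdn b h : 0 < h -> exists p,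
  [/\ prime p, b <= p, ~~ (p %| h) &
    forall q, prime q -> b <= q -> q < p -> q %| h].
Proof.
move=> h0; pose P p := [&& prime p, b <= p & ~~ (p %| h)].
have exP : exists p, P p.
  have [p ltp pp] := prime_above (maxn b h); move: ltp.
  rewrite gtn_max => /andP[bp hp].
  by exists p; rewrite /P pp ltnW //= gtnNdvd.
case: (ex_minnP exP) => p /and3P[pp bp ph] minp; exists p; split=> // q pq bq.
by apply: contraTT => qh; rewrite -leqNgt minp // /P pq bq.
Qed.

Lemma finite_nat_bounded (A : set nat) : finite_set A ->
  exists b, forall p, A p -> p < b.
Proof.
case/finite_seqP=> s ->; exists (\max_(i <- s) i).+1 => p /= ps.
by rewrite ltnS (@leq_bigmax_seq _ _ xpredT id).
Qed.

Local Open Scope ring_scope.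

Lemma horner_nat_bound (R : archiRealFieldType) (f : {poly R}) :
  exists C k, forall p n : nat,
    (0 < p)%N -> n%:R <= f.[p%:R] -> (n <= C * p ^ k)%N.
Proof.
pose S := \sum_(i < size f) `|f`_i|.
exists (Num.truncn S).+1, (size f) => p n p0 nf.
rewrite -(ler_nat R); apply: (le_trans nf).
rewrite natrM natrX; apply: (@le_trans _ _ (S * p%:R ^+ size f)).
  rewrite horner_coef /S mulr_suml; apply: ler_sum => i _.
  apply: le_trans (ler_norm _) _; rewrite normrM ler_wpM2l //.
  rewrite ger0_norm ?exprn_ge0 // ler_weXn2l ?ler1n // ltnW //.
by rewrite ler_wpM2r ?exprn_ge0 // ltW // truncnS_gt.
Qed.

Local Close Scope ring_scope.

(** * Clopen sets in compact totally disconnected spaces *)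

Local Open Scope classical_set_scope.

Definition quasi_component {T : topologicalType} (x : T) : set T :=
  [set y | forall D, clopen D -> D x -> D y].

(** The complement of [O] is compact and covered by complements of clopen
    neighbourhoods of [x]; finitely many suffice, and clopen sets are stable
    under finite intersection. *)
Lemma clopen_in_open_nbhd {T : topologicalType} (x : T) (O : set T) :
  compact [set: T] -> open O -> quasi_component x `<=` O ->
  exists D, [/\ clopen D, D x & D `<=` O].
Proof.
move=> cT oO QO.
pose F := filter_from [set D : set T | clopen D /\ D x] id.
have FF : Filter F.
  apply: filter_from_filter; first by exists setT; split=> //; exact: clopenT.
  move=> A B [cA Ax] [cB Bx]; exists (A `&` B) => //.
  by split=> //; exact: clopenI.
have PF : ProperFilter F by apply: filter_from_proper => D [_ Dx]; exists x.
have : compact (~` O).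
  by apply: (subclosed_compact _ cT) => //; exact: open_closedC.
move=> /compact_near_coveringP /(_ _ _ setC (powerset_filter_from_filter PF))[].
  move=> y nOy.
  have [D [cD Dx nDy]] : exists D, [/\ clopen D, D x & ~ D y].
    apply: contrapT => noD; apply/nOy/QO => D cD Dx; apply: contrapT => nDy.
    by apply: noD; exists D.
  exists (~` D, [set U | U `<=` D]); first split.
  - apply: open_nbhs_nbhs; split=> //.
    by case: cD => _; exact: closed_openC.
  - apply/near_powerset_filter_fromP; first by move=> ? ?; exact: subset_trans.
    by exists D => //; exists D.
  - by case=> i j [? /subsetC]; apply.
move=> S [SF _ [C SC]] /(_ _ SC)/subsetC2 CO.
have [D [cD Dx] DC] := SF _ SC.
by exists D; split=> // y Dy; apply/CO/DC.
Qed.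

(** Separate [A] and [B] by open sets [U] and [~` closure W] with
    [U `<=` closure W].  Some clopen [D] around [x] lies in their union, and
    then [D `&` U = D `&` closure W] is again clopen and contains [x]. *)
Lemma quasi_component_closed_split {T : topologicalType} (x : T) (A B : set T) :
  compact [set: T] -> hausdorff_space T -> closed A -> closed B ->
  A `&` B = set0 -> A x -> quasi_component x `<=` A `|` B ->
  quasi_component x `<=` A.
Proof.
move=> cT hT clA clB AB Ax QAB.
have /(_ A clA (~` B)) [|W AW clWB] := compact_normal hT cT.
  apply/set_nbhsP; exists (~` B); split=> //; first exact: closed_openC.
  exact/disjoints_subset.
have /set_nbhsP[U [oU AU UW]] := AW.
have oV : open (~` closure W) by apply: closed_openC; exact: closed_closure.
have UW' : U `<=` closure W by apply: subset_trans UW _; exact: subset_closure.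
have [|D [cD Dx DO]] := @clopen_in_open_nbhd _ x _ cT (openU oU oV).
  move=> y /QAB[Ay|By]; [left; exact: AU|right=> /clWB]; exact.
have DUE : D `&` U = D `&` closure W.
  apply/seteqP; split=> y [Dy Uy]; split=> //; first exact: UW'.
  by case: (DO y Dy).
have cDU : clopen (D `&` U).
  split; first by apply: openI => //; case: cD.
  by rewrite DUE; apply: closedI; [case: cD|exact: closed_closure].
have DUx : (D `&` U) x by split=> //; exact: AU.
move=> y Qy; have [_ Uy] : (D `&` U) y by exact: Qy.
by case: (QAB _ Qy) => // By; case: (clWB _ (UW' _ Uy)).
Qed.

Lemma closed_quasi_component {T : topologicalType} (x : T) :
  closed (quasi_component x).
Proof.
have -> : quasi_component x = \bigcap_(D in [set D | clopen D /\ D x]) D.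
  apply/seteqP; split=> y Qy D; first by case=> ? ?; exact: Qy.
  by move=> ? ?; exact: Qy.
by apply: closed_bigI => D [[]].
Qed.

(** In a splitting of the quasi-component into two closed pieces, the piece
    containing [x] is everything by [quasi_component_closed_split]; the
    relatively clopen set [B] of the definition of connectedness is one of the
    pieces, so either it contains [x], or it would be empty. *)
Lemma connected_quasi_component {T : topologicalType} (x : T) :
  compact [set: T] -> hausdorff_space T -> connected (quasi_component x).
Proof.
move=> cT hT B [b Bb] [C oC BC] [C' clC' BC'].
have clQ := @closed_quasi_component _ x.
have clB : closed B by rewrite BC'; exact: closedI.
have clB' : closed (quasi_component x `&` ~` C).
  by apply: closedI => //; exact: open_closedC.
have BB'0 : B `&` (quasi_component x `&` ~` C) = set0.
  by rewrite BC -subset0 => y [[_ Cy] []].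
have Qx : quasi_component x x by [].
apply/seteqP; split; first by rewrite BC => y [].
have [Cx|nCx] := pselect (C x).
  apply: (quasi_component_closed_split cT hT clB clB' BB'0).
    by rewrite BC.
  by move=> y Qy; rewrite BC; have [?|?] := pselect (C y); [left|right].
have QB' : quasi_component x `<=` quasi_component x `&` ~` C.
  rewrite setIC in BB'0.
  apply: (quasi_component_closed_split cT hT clB' clB BB'0) => //.
  by move=> y Qy; rewrite BC; have [?|?] := pselect (C y); [right|left].
by move: Bb; rewrite BC => -[/QB'[_ nCb]] /nCb.
Qed.

(** The quasi-component of [x], being connected, lies in the connected
    component [[set x]]. *)
Lemma totally_disconnected_zero_dimensional {T : topologicalType} :
  compact [set: T] -> hausdorff_space T -> totally_disconnected [set: T] ->
  zero_dimensional T.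
Proof.
move=> cT hT tdT x y xy; apply: contrapT => noU.
have : quasi_component x y.
  move=> D cD Dx; apply: contrapT => nDy.
  by apply: noU; exists D.
move=> Qy; have : connected_component [set: T] x y.
  exists (quasi_component x) => //; split=> //.
  exact: connected_quasi_component.
by rewrite tdT // => yx; move: xy; rewrite yx eqxx.
Qed.

(** * Open normal subgroups of profinite groups *)

Lemma cvg_mulg {G : topologicalGroupType} {I : Type} (F : set_system I)
    {FF : Filter F} (f g : I -> G) (a b : G) :
  f @ F --> a -> g @ F --> b -> (fun i => f i * g i)%g @ F --> (a * b)%g.
Proof.
move=> fa gb; apply: (@cvg_comp _ _ _ (fun i => (f i, g i))
  (fun xy : G * G => (xy.1 * xy.2)%g) F (nbhs (a, b))).
  exact: cvg_pair.
exact: (mulg_continuous (a, b)).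
Qed.

Section ProfiniteGroup.
Context {G : topologicalGroupType}.
Implicit Types (N U : set G) (x y g : G).

(** This is the largest normal subgroup of [G] whose translations preserve
    [U]; inserting [g] between both factors, instead of multiplying on one
    side, is what makes it normal without intersecting conjugates. *)
Definition translation_core U : set G :=
  [set g | forall a b, U (a * b)%g <-> U (a * g * b)%g].

Lemma translation_core_normal U : normal_subgroup (translation_core U).
Proof.
split.
- by move=> a b; rewrite mulg1.
- move=> x y Nx Ny a b.
  have := Nx a (y^-1 * b)%g; have := Ny a (y^-1 * b)%g.
  by rewrite -!mulgA mulVKg => <- <-.
- move=> x g Nx a b; have := Nx (a * g^-1)%g (g * b)%g.
  by rewrite conjgE -!mulgA mulKg.
Qed.

Lemma translation_coreS U : U 1%g -> translation_core U `<=` U.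
Proof. by move=> U1 g /(_ 1%g 1%g); rewrite !(mul1g, mulg1) => <-. Qed.

Lemma open_normal_subgroup N : nbhs 1%g N -> normal_subgroup N -> open N.
Proof.
move=> N1 [N_1 Ndiv _]; rewrite openE => x Nx; rewrite /interior.
have xcvg : (x^-1 * y)%g @[y --> x] --> (1%g : G).
  rewrite -(mulVg x); apply: cvg_mulg; [exact: cvg_cst|exact: cvg_id].
have : nbhs x [set y | N (x^-1 * y)%g] := xcvg _ N1.
apply: filterS => y /= Nxy.
have Nx' : N (x^-1)%g by rewrite -[(x^-1)%g]mul1g; exact: Ndiv.
have Nyx : N ((x^-1 * y)^-1)%g by rewrite -[(_^-1)%g]mul1g; exact: Ndiv.
by have := Ndiv _ _ Nx Nyx; rewrite invgK mulVKg.
Qed.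

(** Membership of [a b] and of [a g b] in a clopen set is locally constant in
    [(a, b, g)], so near every [(a, b)] they agree for [g] close to [1];
    compactness of [G * G] makes the neighbourhood of [1] uniform. *)
Lemma translation_core_open U :
  compact [set: G] -> clopen U -> open (translation_core U).
Proof.
move=> cG [oU cU]; apply: open_normal_subgroup; last first.
  exact: translation_core_normal.
have cGG : compact [set: G * G] by rewrite -setXTT; exact: compact_setX.
pose P (g : G) (ab : G * G) := U (ab.1 * ab.2)%g <-> U (ab.1 * g * ab.2)%g.
have : \forall g \near (1%g : G), [set: G * G] `<=` P g.
  move/compact_near_coveringP: cGG; apply=> -[a b] _.
  have ca : (fun z : (G * G) * G => z.1.1) @ nbhs ((a, b), 1%g : G) --> a.
    by apply: (@cvg_comp _ _ _ fst fst _ (nbhs (a, b))); exact: cvg_fst.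
  have cb : (fun z : (G * G) * G => z.1.2) @ nbhs ((a, b), 1%g : G) --> b.
    apply: (@cvg_comp _ _ _ fst snd _ (nbhs (a, b))); first exact: cvg_fst.
    exact: cvg_snd.
  have cg : (fun z : (G * G) * G => z.2) @ nbhs ((a, b), 1%g : G) --> (1%g : G).
    exact: cvg_snd.
  have cab : (fun z : (G * G) * G => (z.1.1 * z.1.2)%g)
      @ nbhs ((a, b), 1%g : G) --> (a * b)%g by exact: cvg_mulg.
  have cagb : (fun z : (G * G) * G => (z.1.1 * z.2 * z.1.2)%g)
      @ nbhs ((a, b), 1%g : G) --> (a * 1 * b)%g.
    by apply: cvg_mulg => //; exact: cvg_mulg.
  rewrite mulg1 in cagb.
  have nbhsP V : open V -> V (a * b)%g ->
      \forall z \near ((a, b), 1%g : G),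
        V (z.1.1 * z.1.2)%g /\ V (z.1.1 * z.2 * z.1.2)%g.
    move=> oV Vab; have nV : nbhs (a * b)%g V by exact: open_nbhs_nbhs.
    by apply: filterI; [exact: (cab _ nV)|exact: (cagb _ nV)].
  have [Uab|nUab] := pselect (U (a * b)%g).
    by apply: filterS (nbhsP U oU Uab) => -[[? ?] ?] [].
  by apply: filterS (nbhsP _ (closed_openC cU) nUab) => -[[? ?] ?] [].
by apply: filterS => g Ug a b; exact: (Ug (a, b) I).
Qed.

Lemma open_normal_avoiding (x : G) : profinite G -> x != 1%g ->
  exists N, [/\ open N, normal_subgroup N & ~ N x].
Proof.
move=> [cG hG tG]; rewrite eq_sym => x1.
have [U [cU U1 nUx]] := totally_disconnected_zero_dimensional cG hG tG x1.
exists (translation_core U); split.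
- exact: translation_core_open.
- exact: translation_core_normal.
- by move/(translation_coreS U1).
Qed.

Lemma normal_subgroupI N N' : normal_subgroup N -> normal_subgroup N' ->
  normal_subgroup (N `&` N').
Proof.
move=> [N1 Nd NJ] [N'1 N'd N'J]; split=> //.
- by move=> x y [? ?] [? ?]; split; [exact: Nd|exact: N'd].
- by move=> x g [? ?]; split; [exact: NJ|exact: N'J].
Qed.

Lemma open_normal_avoiding_seq (s : seq G) : profinite G ->
  exists N, [/\ open N, normal_subgroup N
              & forall x, x \in s -> N x -> x = 1%g].
Proof.
move=> pG; elim: s => [|x s [N [oN nN Ns]]].
  by exists setT; split=> //; exact: openT.
have [->|x1] := eqVneq x 1%g.
  by exists N; split=> // y; rewrite inE => /orP[/eqP|/Ns].
have [N' [oN' nN' N'x]] := open_normal_avoiding pG x1.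
exists (N `&` N'); split; [exact: openI|exact: normal_subgroupI|].
by move=> y; rewrite inE => /orP[/eqP -> [_ /N'x]|ys [/(Ns _ ys)]].
Qed.

(** * Orders of finite quotients *)

Lemma left_coset_eqP N x y : normal_subgroup N ->
  left_coset x N = left_coset y N <-> N (x^-1 * y)%g.
Proof.
move=> [N1 Nd _]; have NV z : N z -> N (z^-1)%g.
  by move=> Nz; rewrite -[(z^-1)%g]mul1g; exact: Nd.
have NM z t : N z -> N t -> N (z * t)%g.
  by move=> Nz Nt; rewrite -[t]invgK; apply: Nd => //; exact: NV.
split=> [xy|Nxy].
  have : left_coset y N y by exists 1%g; rewrite ?mulg1.
  by rewrite -xy => -[z Nz <-]; rewrite mulKg.
apply/seteqP; split=> _ [z Nz <-].
  exists ((x^-1 * y)^-1 * z)%g; first by apply: NM => //; exact: NV.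
  by rewrite invgM invgK -!mulgA !mulVKg.
by exists ((x^-1 * y) * z)%g; [exact: NM|rewrite -!mulgA mulVKg].
Qed.

(** The cosets are open, so by compactness a finite set [S] of
    representatives meets all of them; compactness is used along the filter of
    all large enough finite sets [S]. *)
Lemma cosets_finite N : compact [set: G] -> open N -> normal_subgroup N ->
  finite_set (cosets N).
Proof.
move=> cG oN nN; have [N1 _ _] := nN.
pose F := filter_from [set: {fset G}] (fun S => [set S' | S `<=` S']%fset).
have FF : Filter F.
  apply: filter_from_filter; first by exists fset0.
  move=> S1 S2 _ _; exists (S1 `|` S2)%fset => // S.
  by rewrite /= fsubUset => /andP[].
pose P (S : {fset G}) x := exists2 y, y \in S & N (y^-1 * x)%g.
have : \forall S \near F, [set: G] `<=` P S.
  move/compact_near_coveringP: cG; apply=> x _.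
  have xcvg : (x^-1 * y)%g @[y --> x] --> (1%g : G).
    by rewrite -(mulVg x); apply: cvg_mulg; [exact: cvg_cst|exact: cvg_id].
  exists ([set y | N (x^-1 * y)%g], [set S | x \in S]).
    split; first by apply: xcvg; exact: open_nbhs_nbhs.
    by exists [fset x]%fset => // S /=; rewrite fsub1set.
  by case=> y S [Nxy xS]; exists x.
case=> S _ /(_ S (fsubset_refl S)) cS.
apply: (@sub_finite_set _ _ (left_coset^~ N @` [set` S])).
  move=> _ [x _ <-]; have [y Sy Nyx] := cS x I.
  by exists y => //; apply/left_coset_eqP.
exact/finite_image/finite_fset.
Qed.

(** Otherwise take [B + 1] distinct points of [G] and an open normal subgroup
    containing none of the nontrivial quotients [x^-1 y] of these points: they
    lie in distinct cosets. *)
Lemma profinite_finite B : profinite G ->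
  (forall N, open N -> normal_subgroup N -> #|` fset_set (cosets N)| <= B) ->
  finite_set [set: G].
Proof.
move=> pG NB; have [cG _ _] := pG.
apply: contrapT => /(@infinite_set_fset _ _ B.+1) [S _ BS].
have [N [oN nN NS]] :=
  open_normal_avoiding_seq [seq x^-1 * y | x <- S, y <- S]%g pG.
have := NB N oN nN; rewrite leqNgt => /negP; apply; apply: leq_trans BS _.
pose f := left_coset^~ N.
have <- : #|` [fset f x | x in S]%fset| = #|` S|.
  apply: card_in_imfset => x y /= xS yS /left_coset_eqP -/(_ nN) /NS.
  have xyS : (x^-1 * y)%g \in [seq x^-1 * y | x <- S, y <- S]%g.
    exact: allpairs_f.
  by move=> /(_ xyS) xy; apply: (mulgI (x^-1)%g); rewrite xy mulVg.
apply/fsubset_leq_card/fsubsetP => _ /imfsetP[x /= _ ->].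
rewrite in_fset_set; last exact: cosets_finite.
by rewrite inE; exists x.
Qed.

(** Evaluation at [N] maps the projective limit onto [G / N], since the coset
    of [g] is the value at [N] of the coherent family of all cosets of [g]. *)
Lemma card_cosets_le N p n : profinite G -> open N -> normal_subgroup N ->
  coprime p #|` fset_set (cosets N)| -> has_order (prime_to_quotient G p) n ->
  #|` fset_set (cosets N)| <= n.
Proof.
move=> [cG _ _] oN nN cop [fQ <-].
have fN := cosets_finite cG oN nN.
have kN : prime_to_kernels G p N.
  by split=> //; exists #|` fset_set (cosets N)|.
pose N' : prime_to_kernels G p := exist _ N (mem_set kN).
pose ev (x : prime_to_kernels G p -> set G) := x N'.
apply: (@leq_trans #|` (ev @` fset_set (prime_to_quotient G p))%fset|);
  last first.
  exact: leq_imfset_card.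
rewrite -fset_set_image //; apply: fsubset_leq_card.
rewrite -fset_set_sub //; last exact: finite_image.
move=> _ [g _ <-]; exists (fun M => left_coset g (val M)) => //.
split=> [M|M M' MM' _ [z Mz <-]]; first by exists g.
by exists z => //; exact: MM'.
Qed.
End ProfiniteGroup.

Local Open Scope ring_scope.

Theorem proposition5p1 (R : realType) (G : topologicalGroupType)
  (hG : profinite G)
  (hbound : exists f : {poly R},
     finite_set [set p : nat | prime p /\
       ~ (exists2 n : nat, has_order (prime_to_quotient G p) n
                         & n%:R <= f.[p%:R])]) :
  finite_set [set: G].
Proof.
have [f /finite_nat_bounded[b0 ltb0]] := hbound.
have [C [k fC]] := horner_nat_bound f.
pose b := maxn b0 (2 * 4 ^ k)%N.
have [M leM] := @leq_of_primes_dvdn b C k (leq_maxr _ _).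
apply: (@profinite_finite _ M hG) => N oN nN.
set h := #|` _|.
have h0 : (0 < h)%N.
  have [cG _ _] := hG.
  rewrite cardfs_gt0; apply/fset0Pn; exists (left_coset 1%g N).
  rewrite in_fset_set ?inE; first by exists 1%g.
  exact: cosets_finite.
have [p [pp bp ph minp]] := least_prime_not_dvdn b h0.
have [n Gn nf] : exists2 n : nat, has_order (prime_to_quotient G p) n
                                & n%:R <= f.[p%:R].
  apply: contrapT => bad; have /ltb0 := conj pp bad.
  by apply/negP; rewrite -leqNgt (leq_trans _ bp) // leq_maxl.
apply: (leM p h h0 minp); apply: leq_trans (fC _ _ (prime_gt0 pp) nf).
by apply: card_cosets_le Gn => //; rewrite prime_coprime.
Qed.
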